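(* Let $\mathbb{F}_q$ be a finite field and let $a\in M_n(\mathbb{F}_q)$ have rank $r$. Then $$K_n(a,0)=(-1)^rq^{-r(r+1)/2}q^{rn}\,|\mathrm{GL}_{n-r}(\mathbb{F}_q)|.$$
   Context: $\mathbb{F}_q$ is a finite field of characteristic $p$. The additive character $\varphi:\mathbb{F}_q\to\mathbb{C}^*$ is $\varphi(x)=\exp(2\pi i\,\mathrm{Tr}_{\mathbb{F}_q/\mathbb{F}_p}(x)/p)$, and $\psi=\varphi\circ\mathrm{tr}$ on $M_n(\mathbb{F}_q)$, where $\mathrm{tr}$ is the matrix trace. For $a,b\in M_n(\mathbb{F}_q)$, $K_n(a,b)=\sum_{x\in \mathrm{GL}_n(\mathbb{F}_q)}\psi(ax+bx^{-1})$. Convention: $|\mathrm{GL}_0(\mathbb{F}_q)|=1$. *)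

(* Defs.v *)
From HB Require Import structures.
From mathcomp Require Import all_boot all_order all_algebra all_fingroup.
From mathcomp Require Import all_field.
From mathcomp Require Import complex.
From mathcomp Require Import reals trigo.

Set Implicit Arguments.
Unset Strict Implicit.
Unset Printing Implicit Defensive.

Import GRing.Theory.
Local Open Scope ring_scope.

(* The complex exponential on the imaginary axis: expi t = exp(i t). *)
Definition expi (R : realType) (t : R) : R[i] := Complex (cos t) (sin t).

(* Tr_{F_q/F_p}. galTrace takes its values in the line 1%VS = F_p * 1 of F_q;
   the coordinate on the basis [:: 1] reads such a value as an element of 'F_p
   (see absTrE). *)
Definition absTr (F : finFieldType) (p : nat) (charFp : p \in [pchar F])
    (x : F) : 'F_p :=
  let L : splittingFieldType 'F_p := pPrimeCharType charFp in
  coord [tuple (1 : L)] ord0 (galTrace 1%VS {:L}%VS (x : L)).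

Lemma absTrE (F : finFieldType) (p : nat) (charFp : p \in [pchar F]) (x : F) :
  let L : splittingFieldType 'F_p := pPrimeCharType charFp in
  (absTr charFp x)%:A = galTrace 1%VS {:L}%VS (x : L).
Proof.
move=> L; have galL : galois 1%AS {:L}%AS by apply: finField_galois (sub1v _).
have /vlineP[k Dk] : galTrace 1%VS {:L}%VS (x : L) \in 1%VS.
  exact: mem_galTrace galL (memvf _).
have free1 : free [tuple (1 : L)] by rewrite seq1_free oner_neq0.
rewrite /absTr -/L Dk linearZ /=.
have -> : coord [tuple (1 : L)] ord0 1 = 1.
  by have /= -> := coord_free ord0 ord0 free1.
by rewrite mulr1.
Qed.

Definition phi (R : realType) (F : finFieldType) (p : nat)
    (charFp : p \in [pchar F]) (x : F) : R[i] :=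
  expi (2 * pi * (absTr charFp x : nat)%:R / p%:R).

Definition psi (R : realType) (F : finFieldType) (p : nat)
    (charFp : p \in [pchar F]) (n : nat) (x : 'M[F]_n) : R[i] :=
  phi R charFp (\tr x).

(* The library's 'GL_n[F] consists of matrices of size n.-1.+1, so it is not
   GL_n when n = 0; this set is, and has one element for n = 0. *)
Definition GLset (F : finFieldType) (n : nat) : {set 'M[F]_n} :=
  [set x | x \in unitmx].

Lemma card_GLset0 (F : finFieldType) : #|GLset F 0| = 1%N.
Proof.
rewrite (_ : GLset F 0 = setT); first by rewrite cardsT card_mx mul0n expn0.
by apply/setP=> x; rewrite !inE unitmxE det_mx00 unitr1.
Qed.

Definition Kn (R : realType) (F : finFieldType) (p : nat)
    (charFp : p \in [pchar F]) (n : nat) (a b : 'M[F]_n) : R[i] :=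
  \sum_(x in GLset F n) psi R charFp (a *m x + b *m invmx x).

(* Main.v *)
Require Import Defs.
From mathcomp Require Import all_boot all_order all_algebra all_fingroup.
From mathcomp Require Import all_field.
From mathcomp Require Import complex.
From mathcomp Require Import reals trigo.
From mathcomp Require Import ring lra.

Set Implicit Arguments.
Unset Strict Implicit.
Unset Printing Implicit Defensive.

Import Order.TTheory GRing.Theory Num.Theory.
Local Open Scope ring_scope.

(** The theorem holds because raising the rank by one and the size from [n] to
[n + 1] multiplies the sum by [- q ^+ n].

Since [x |-> U^-1 x L^-1] permutes GL_n and the trace is cyclic, the sum
depends only on the rank of [a] ([gl_char_sum_rank]), so [a] may be taken to be
the partial identity [pid_mx r].  For [r > 0] this matrix is the block sum of
[1] and a partial identity of rank [r - 1]; correspondingly write an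
invertible [x] of size [n + 1] as [[c, u; v, y]] with [c] a scalar.  The
character takes the value [chi c * chi (tr (a' y))] on it, and the sum over [c]
with [u], [v], [y] fixed is governed by the fact that [det x] is affine in [c]
with slope [det y]:
- if [y] is singular, invertibility of [x] does not depend on [c], and summing
  a nontrivial character over the whole field gives 0;
- if [y] is invertible, the only excluded value of [c] is [u y^-1 v] (Schur
  complement), and the sum is [- chi (u y^-1 v)].
By orthogonality of characters, summing [chi (u y^-1 v)] over the row [u] kills
all columns [v] but [v = 0], which contributes [q ^+ n].  What remains is
[- q ^+ n] times the sum for [a'] over GL_n ([gl_char_sum_block]).  Iterating
down to rank 0, where the sum is the cardinal of GL_(n - r), yields the formula
([gl_char_sum_pid]).

Of the character only additivity and nontriviality matter, so this is done for
an arbitrary [chi].  For the trace character [phi], nontriviality combines the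
linear independence of field automorphisms, by which the trace to the prime
field is not identically zero, with the fact that [exp (2 i pi k / p)] is not 1
for [0 < k < p]. *)

(** * Two determinants of matrices bordered by one row and one column *)

(** The determinant is affine in its corner entry: expand it linearly in the
first row, written as [c * (1, 0) + (0, u)]. *)
Lemma det_block_corner (K : comNzRingType) n (c : K)
    (u : 'rV_n) (v : 'cV_n) (y : 'M[K]_n) :
  \det (block_mx c%:M u v y) = c * \det y + \det (block_mx 0 u v y).
Proof.
have := @determinant_multilinear _ _ (block_mx c%:M u v y) (block_mx 1%:M 0 v y)
  (block_mx 0 u v y) (lshift n ord0) c 1.
rewrite mul1r det_lblock det1 mul1r; apply.
- apply/rowP=> j; rewrite !mxE (unsplitK (inl _)) !mxE.
  case: (split j) => k; rewrite !mxE.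
    by rewrite !ord1 mulr1n mulr1 mulr0 addr0.
  by rewrite mulr0 add0r mul1r.
- apply/matrixP=> i j; rewrite !mxE.
  have -> : lift (lshift n ord0) i = rshift 1 i by apply: val_inj.
  by rewrite (unsplitK (inr _)).
- apply/matrixP=> i j; rewrite !mxE.
  have -> : lift (lshift n ord0) i = rshift 1 i by apply: val_inj.
  by rewrite (unsplitK (inr _)).
Qed.

(** Clearing [u] by a unipotent row operation leaves the Schur complement of
[y] in the corner. The scalar [u y^-1 v] is written as a trace because it is a
one by one matrix. *)
Lemma det_block_Schur (K : fieldType) n (c : K)
    (u : 'rV_n) (v : 'cV_n) (y : 'M[K]_n) :
  y \in unitmx ->
  \det (block_mx c%:M u v y) = (c - \tr (u *m (invmx y *m v))) * \det y.
Proof.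
move=> uy; set s := \tr _.
have -> : block_mx c%:M u v y =
  block_mx 1%:M (u *m invmx y) 0 1%:M *m block_mx (c - s)%:M 0 v y.
  rewrite mulmx_block !mul0mx !mulmx0 !mul1mx !add0r.
  rewrite -!mulmxA mulVmx // mulmx1; congr (block_mx _ _ _ _).
  by rewrite raddfB /= /s trace_mx11 -mx11_scalar subrK.
by rewrite det_mulmx det_ublock det_lblock !det1 !mul1r det_scalar1.
Qed.

(** * Sums of additive characters *)

(** Translating the index by [y] multiplies the sum by [f y], which is not 1. *)
Lemma sum_nontrivial_char (V : finZmodType) (C : idomainType) (f : V -> C) y :
  {morph f : x z / x + z >-> x * z} -> f y != 1 -> \sum_x f x = 0.
Proof.
move=> fD fy1; set S := \sum_x f x.
have: S * (f y - 1) == 0.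
  rewrite mulrBr mulr1 subr_eq0 /S mulr_suml; apply/eqP.
  rewrite [RHS](reindex_inj (addIr y)) /=.
  by apply: eq_bigr => x _; rewrite fD.
by rewrite mulf_eq0 [X in _ || X]subr_eq0 (negPf fy1) orbF => /eqP.
Qed.

Section CharacterSums.

Variables (F : finFieldType) (C : numFieldType) (chi : F -> C).
Hypothesis chi0 : chi 0 = 1.
Hypothesis chiD : {morph chi : x y / x + y >-> x * y}.
Hypothesis chi_nontrivial : exists y, chi y != 1.

Let q : C := #|F|%:R.

Lemma sum_char : \sum_x chi x = 0.
Proof. by have [y] := chi_nontrivial; apply: sum_nontrivial_char. Qed.

(** Orthogonality: for [v != 0] the character [u |-> chi (u v)] of the space of
rows is nontrivial, since [u v] takes every value of the field. *)
Lemma sum_char_rV n (v : 'cV[F]_n) :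
  \sum_(u : 'rV_n) chi (\tr (u *m v)) = if v == 0 then q ^+ n else 0.
Proof.
case: eqP => [->|/eqP].
  rewrite (eq_bigr (fun _ => 1)) => [|u _]; last by rewrite mulmx0 mxtrace0 chi0.
  by rewrite sumr_const card_mx mul1n natrX.
case/cV0Pn=> i nz_vi; have [y chi_y] := chi_nontrivial.
apply: (@sum_nontrivial_char _ _ _ ((y / v i 0) *: delta_mx 0 i)).
  by move=> u w; rewrite mulmxDl mxtraceD chiD.
by rewrite -scalemxAl -rowE mxtraceZ trace_mx11 mxE divfK.
Qed.

(** * Character sums over the general linear group *)

Definition gl_char_sum n (a : 'M[F]_n) : C :=
  \sum_(x in GLset F n) chi (\tr (a *m x)).

(** By affineness of the determinant in [c], the condition on [c] is vacuous or
contradictory when [y] is singular, and otherwise excludes just one value; the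
sum over the complement of that value is minus its term, the full sum being
zero. *)
Lemma sum_char_corner n (u : 'rV_n) (v : 'cV_n) (y : 'M[F]_n) :
  \sum_(c | block_mx c%:M u v y \in unitmx) chi c =
  if y \in unitmx then - chi (\tr (u *m (invmx y *m v))) else 0.
Proof.
case: ifPn => [uy|nuy]; last first.
  under eq_bigl => c.
    rewrite unitmxE det_block_corner.
    move: nuy; rewrite unitmxE unitfE negbK => /eqP->; rewrite mulr0 add0r.
  over.
  by case: (_ \is a _); [apply: sum_char | apply: big_pred0].
apply/eqP; rewrite -addr_eq0; apply/eqP.
rewrite -[RHS]sum_char addrC [RHS](bigD1 (\tr (u *m (invmx y *m v)))) //=.
congr (_ + _); apply: eq_bigl => c.
rewrite unitmxE det_block_Schur // unitrM -[\det y \is a _]unitmxE uy andbT.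
by rewrite unitfE subr_eq0.
Qed.

(** The factor [-1] comes from the sum over the corner, and [q ^+ n] from the
orthogonality relation for the rest of the first row, which forces the rest of
the first column to vanish; the lower right block then ranges over GL_n. *)
Lemma gl_char_sum_block n (a : 'M[F]_n) :
  gl_char_sum (block_mx 1%:M 0 0 a : 'M_(1 + n)) = - q ^+ n * gl_char_sum a.
Proof.
pose blk (t : 'M[F]_n * ('cV[F]_n * 'rV[F]_n) * F) : 'M[F]_(1 + n) :=
  block_mx t.2%:M t.1.2.2 t.1.2.1 t.1.1.
pose unblk (x : 'M[F]_(1 + n)) :=
  (drsubmx x, (dlsubmx x, ursubmx x), ulsubmx x 0 0).
have blkK : cancel blk unblk.
  move=> [[y [v u]] c]; rewrite /unblk /blk /=.
  by rewrite block_mxKul block_mxKur block_mxKdl block_mxKdr mxE eqxx mulr1n.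
have unblkK : cancel unblk blk.
  by move=> x; rewrite /blk /= -mx11_scalar submxK.
(* The corner c is the innermost summation variable. *)
rewrite /gl_char_sum (reindex blk) /=; last by exists unblk => ? _.
rewrite (eq_bigl (fun t => true && (blk t \in unitmx))); last first.
  by move=> t; rewrite inE.
rewrite -(pair_big_dep predT (fun s c => blk (s, c) \in unitmx)
   (fun s c => chi (\tr (block_mx 1%:M 0 0 a *m blk (s, c))))) /=.
have inner (s : 'M[F]_n * ('cV[F]_n * 'rV[F]_n)) :
    \sum_(c | blk (s, c) \in unitmx)
      chi (\tr (block_mx 1%:M 0 0 a *m blk (s, c)))
  = if s.1 \in unitmx then
      - (chi (\tr (a *m s.1)) * chi (\tr (s.2.2 *m (invmx s.1 *m s.2.1)))) else 0.
  transitivity (chi (\tr (a *m s.1)) * \sum_(c | blk (s, c) \in unitmx) chi c).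
    rewrite mulr_sumr; apply: eq_bigr => c _.
    rewrite mulmx_block !mul0mx !mul1mx !addr0 !add0r mxtrace_block.
    by rewrite mxtrace_scalar mulr1n chiD mulrC.
  by rewrite sum_char_corner; case: ifP; rewrite ?mulr0 ?mulrN.
rewrite (eq_bigr _ (fun s _ => inner s)) -big_mkcond /=.
rewrite (eq_bigl (fun s => (s.1 \in unitmx) && true)); last first.
  by move=> s; rewrite andbT.
rewrite -(pair_big_dep (fun y : 'M[F]_n => y \in unitmx) (fun _ _ => true)
   (fun y t => - (chi (\tr (a *m y)) * chi (\tr (t.2 *m (invmx y *m t.1)))))) /=.
(* For each invertible y, the remaining sum over v and u is q ^+ n. *)
rewrite mulr_sumr; apply: eq_big => [y | y uy]; first by rewrite inE.
rewrite sumrN -mulr_sumr mulNr mulrC; congr (- (_ * _)).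
rewrite -(pair_bigA _ (fun v u => chi (\tr (u *m (invmx y *m v))))) /=.
rewrite (eq_bigr _ (fun v _ => sum_char_rV (invmx y *m v))) (bigD1 0) //=.
rewrite mulmx0 eqxx big1 ?addr0 // => v nz_v; rewrite ifN //.
by apply: contraNneq nz_v => yv0; rewrite -(mulKVmx uy v) yv0 mulmx0.
Qed.

(** Gaussian elimination gives [a = L * pid_mx (\rank a) * U] with [L] and [U]
invertible; substituting [U^-1 x L^-1] for [x] and using cyclicity of the trace
absorbs both factors. *)
Lemma gl_char_sum_rank n (a : 'M[F]_n) :
  gl_char_sum a = gl_char_sum (pid_mx (\rank a) : 'M_n).
Proof.
pose L := col_ebase a; pose U := row_ebase a.
have uL : L \in unitmx by apply: col_ebase_unit.
have uU : U \in unitmx by apply: row_ebase_unit.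
rewrite {1}/gl_char_sum (reindex (fun x => invmx U *m x *m invmx L)) /=;
  last first.
  exists (fun x => U *m x *m L) => x _.
    by rewrite -!mulmxA mulKVmx // mulVmx // mulmx1.
  by rewrite -!mulmxA mulKmx // mulmxV // mulmx1.
apply: eq_big => [x|x _].
  by rewrite !inE !unitmx_mul !unitmx_inv uL uU andbT.
rewrite -{1}(mulmx_ebase a) -/L -/U; congr chi.
rewrite mxtrace_mulC -!mulmxA mulKmx //.
by rewrite mxtrace_mulC -!mulmxA mulmxV // mulmx1 mxtrace_mulC.
Qed.

(** Passing from [(r, n)] to [(r + 1, n + 1)] raises the exponent
[r n - r (r + 1) / 2] of [q] by exactly [n] and leaves [n - r] unchanged, which
matches the factor [- q ^+ n] of the recursion. *)
Lemma gl_char_sum_pid n r : (r <= n)%N ->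
  gl_char_sum (pid_mx r : 'M_n) =
  (-1) ^+ r * q ^- ((r * r.+1) %/ 2) * q ^+ (r * n) * #|GLset F (n - r)|%:R.
Proof.
have nz_q : q != 0 by rewrite pnatr_eq0 -lt0n; apply/card_gt0P; exists 0.
elim: r n => [n _|r IHr [|n] // le_rn].
  (* Every term is chi 0 = 1. *)
  rewrite pid_mx_0 /gl_char_sum (eq_bigr (fun _ => 1)) => [|x _].
    by rewrite sumr_const subn0 div0n !expr0 invr1 !mul1r.
  by rewrite mul0mx mxtrace0 chi0.
have -> : pid_mx r.+1 = block_mx 1%:M 0 0 (pid_mx r) :> 'M[F]_(1 + n).
  apply/matrixP=> i j.
  case: (split_ordP i) => i' ->; case: (split_ordP j) => j' ->.
  - by rewrite block_mxEul !mxE !ord1.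
  - by rewrite block_mxEur !mxE ord1.
  - by rewrite block_mxEdl !mxE ord1.
  - by rewrite block_mxEdr !mxE.
rewrite gl_char_sum_block IHr // subSS.
have -> : (r.+1 * r.+2 %/ 2 = r * r.+1 %/ 2 + r.+1)%N.
  have -> : (r.+1 * r.+2 = r.+1 * 2 + r * r.+1)%N by ring.
  by rewrite divnMDl // addnC.
have -> : (r.+1 * n.+1 = r * n + n + r.+1)%N by ring.
rewrite !exprD invfM [(-1) ^+ r.+1]exprS.
have nz_z : q ^+ r.+1 != 0 by rewrite expf_neq0.
move: (q ^+ r.+1) (q ^- _) (q ^+ n) (q ^+ (r * n)) ((-1) ^+ r) nz_z => z Q x y e.
by move: (_%:R : C) => c nz_z; field.
Qed.

End CharacterSums.

(** * The trace character of a finite field *)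

Section TraceCharacter.

Variables (R : realType) (F : finFieldType) (p : nat).
Hypothesis charFp : p \in [pchar F].

Lemma expiD (s t : R) : expi (s + t) = expi s * expi t.
Proof. by rewrite /expi cosD sinD; simpc; rewrite [sin s * _ + _]addrC. Qed.

Lemma expi0 : expi (0 : R) = 1.
Proof. by rewrite /expi cos0 sin0. Qed.

Lemma expi_2pi_nat k : expi (2 * pi * k%:R : R) = 1.
Proof.
elim: k => [|k IHk]; first by rewrite mulr0 expi0.
rewrite [k.+1%:R]mulrSr mulrDr expiD IHk mul1r mulr1 mulr_natl.
by rewrite /expi cos2pi sin2pi.
Qed.

(** The half angle is used because [1 - cos (2 t) = 2 (sin t)^2], and the sine
is positive on the whole open interval from 0 to pi. *)
Lemma expi_double_neq1 (t : R) : 0 < t < pi -> expi (t *+ 2) != 1.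
Proof.
move=> /sin_gt0_pi st; apply/negP=> /eqP[]; rewrite cos_mulr2n cos2sin2 => eq1 _.
suff: sin t ^+ 2 = 0 by apply/eqP; rewrite expf_neq0 // gt_eqF.
by lra.
Qed.

Lemma absTrD : {morph absTr charFp : x y / x + y}.
Proof. by move=> x y; rewrite /absTr raddfD linearD. Qed.

(** The trace is the sum of all elements of the Galois group, hence a linear
combination of distinct automorphisms with nonzero coefficients; such a
combination cannot vanish identically. *)
Lemma absTr_nontrivial : exists x, absTr charFp x != 0.
Proof.
pose L : splittingFieldType 'F_p := pPrimeCharType charFp.
have [x _ nz] := @gal_independent_contra _ L {:L}%AS [in 'Gal({:L} / 1)%g]
  (fun _ => 1) 1%g (group1 _) (oner_neq0 _).
exists x; apply: contraNneq nz => Tr0.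
have TrL0 : galTrace 1%VS {:L}%VS x = 0.
  by rewrite -(absTrE charFp) Tr0 [LHS]scale0r.
by rewrite -[X in _ == X]TrL0; apply/eqP/eq_bigr => y _; rewrite mul1r.
Qed.

Lemma phi0 : phi R charFp 0 = 1.
Proof.
have Tr0 : absTr charFp 0 = 0 :> nat by rewrite /absTr raddf0 linear0.
by rewrite /phi Tr0 mulr0 mul0r expi0.
Qed.

(** Addition in the prime field is addition of representatives modulo [p];
dropping a multiple of [p] changes the angle by a multiple of [2 pi]. *)
Lemma phiD : {morph phi R charFp : x y / x + y >-> x * y}.
Proof.
have p_pr := pcharf_prime charFp.
have nz_p : p%:R != 0 :> R by rewrite pnatr_eq0 -lt0n prime_gt0.
move=> x y; rewrite /phi absTrD -expiD -mulrDl -mulrDr -natrD.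
set u := absTr _ x; set v := absTr _ y.
have -> : (u + v : 'F_p) = ((u + v) %% p)%N :> nat.
  by rewrite /= [X in (_ %% X)%N = _]Fp_cast.
rewrite {2}(divn_eq (u + v) p) [(_ %/ _ * _ + _)%:R]natrD natrM.
rewrite (mulrDr (2 * pi)) mulrDl expiD.
by rewrite mulrA mulfK // expi_2pi_nat mul1r.
Qed.

Lemma phi_nontrivial : exists x, phi R charFp x != 1.
Proof.
have p_pr := pcharf_prime charFp.
have p_gt0 : 0 < p%:R :> R by rewrite ltr0n prime_gt0.
have [x nz_Tr] := absTr_nontrivial; exists x; rewrite /phi.
set k := nat_of_ord _; have k_gt0 : (0 < k)%N by rewrite lt0n.
have ltkp : (k < p)%N by rewrite -[X in (_ < X)%N](Fp_cast p_pr) ltn_ord.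
have -> : 2 * pi * k%:R / p%:R = (pi * (k%:R / p%:R)) *+ 2 :> R.
  by rewrite -!mulrA mulr_natl.
apply: expi_double_neq1; rewrite mulr_gt0 ?pi_gt0 ?divr_gt0 // ?ltr0n //=.
by rewrite gtr_pMr ?pi_gt0 // ltr_pdivrMr // mul1r ltr_nat.
Qed.

End TraceCharacter.

Theorem theorem1p9 (R : realType) (F : finFieldType) (p : nat)
    (charFp : p \in [pchar F]) (n r : nat) (a : 'M[F]_n) (ra : \rank a = r) :
  let q : R[i] := #|F|%:R in
  Kn R charFp a 0 =
    (-1) ^+ r * q ^- ((r * r.+1) %/ 2) * q ^+ (r * n) * #|GLset F (n - r)|%:R.
Proof.
move=> q; have -> : Kn R charFp a 0 = gl_char_sum (phi R charFp) a.
  by apply: eq_bigr => x _; rewrite mul0mx addr0.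
rewrite gl_char_sum_rank ra; apply: gl_char_sum_pid.
- exact: phi0.
- exact: phiD.
- exact: phi_nontrivial.
- by rewrite -ra rank_leq_row.
Qed.
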